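(* Let $(T_t)_{t\in\mathbb{R}}$ be a measure-preserving flow on a standard probability space $(X,\mu)$ that has a rigid factor. Then $T_t$ is not almost mixing.
   Context: A flow $(T_t)_{t\in\mathbb{R}}$ is a (jointly measurable) measure-preserving action of $\mathbb{R}$ on a standard probability space $(X,\mu)$. The flow is said to have a rigid factor if there exist a measurable set $A\subset X$ with $0<\mu(A)<1$ and a sequence $t(i)\to\infty$ such that $\mu(A\cap T_{t(i)}A)\to\mu(A)$. A flow is called almost mixing if it is ergodic and for every continuous (i.e. atomless) Borel probability measure $\nu$ on $\mathbb{R}$ and every $f\in L_1(X,\mu)$, $$\left\|\int_{\mathbb{R}} f(T_{rt}x)\, d\nu(r) -\int_X f \, d\mu\right\|_{L_1(\mu)}\to 0\quad\text{as } t\to +\infty .$$ *)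

(* Defs.v *)
From HB Require Import structures.
From mathcomp Require Import all_boot all_order all_algebra.
From mathcomp Require Import all_classical all_reals all_analysis.
Import Order.TTheory GRing.Theory Num.Theory.
Import numFieldNormedType.Exports.

Set Implicit Arguments.
Unset Strict Implicit.
Unset Printing Implicit Defensive.

Local Open Scope classical_set_scope.
Local Open Scope ring_scope.

(* A Hausdorff [completePseudoMetricType] is a complete metric space. *)
Definition polish (R : realType) (P : completePseudoMetricType R) : Prop :=
  hausdorff_space P /\ exists2 D : set P, countable D & dense D.

Definition borelType (P : ptopologicalType) := g_sigma_algebraType (@open P).

(* A standard probability space is a standard Borel space together with a
   [probability] on it. *)
Definition standard_borel (R : realType) (d : measure_display)
    (X : measurableType d) : Prop :=
  exists (P : completePseudoMetricType R) (phi : X -> borelType P),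
    [/\ polish P,
        bijective phi,
        measurable_fun setT phi &
        forall A : set X, measurable A -> measurable (phi @` A)].

Section flows.
Context (R : realType) (d : measure_display) (X : measurableType d).
Variable mu : probability X R.

Record measure_preserving_flow (T : R -> X -> X) : Prop :=
  MeasurePreservingFlow {
    flow0 : forall x, T 0 x = x;
    flowD : forall s t x, T (s + t) x = T s (T t x);
    flow_measurable :
      measurable_fun [set: measurableTypeR R * X] (fun p => T p.1 p.2);
    flow_preserving :
      forall t (A : set X), measurable A -> mu (T t @^-1` A) = mu A }.

Definition has_rigid_factor (T : R -> X -> X) : Prop :=
  exists A : set X,
    [/\ measurable A, (0 < mu A)%E, (mu A < 1)%E &
      exists2 t : nat -> R, t i @[i --> \oo] --> +oo &
        mu (A `&` T (t i) @` A) @[i --> \oo] --> mu A].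

(* For a jointly measurable action, strict invariance and invariance modulo
   null sets for each [t] give the same notion. *)
Definition ergodic_flow (T : R -> X -> X) : Prop :=
  forall A : set X, measurable A -> (forall t, T t @` A = A) ->
    mu A = 0%E \/ mu A = 1%E.

Definition atomless (nu : probability (measurableTypeR R) R) : Prop :=
  forall r : R, nu [set r] = 0%E.

(* By Fubini, [r |-> f (T (r * t) x)] is [nu]-integrable for [mu]-almost all
   [x]; the values of the inner integral at the other [x] do not affect the
   norm. *)
Definition almost_mixing (T : R -> X -> X) : Prop :=
  ergodic_flow T /\
  forall nu : probability (measurableTypeR R) R, atomless nu ->
  forall f : X -> R, f \in Lfun mu 1%E ->
    ('N[mu]_1[(fun x => (\int[nu]_r (f (T (r * t) x))%:E)
                        - (\int[mu]_y (f y)%:E))])%E @[t --> +oo] --> 0%E.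

End flows.

(* Main.v *)
Require Import Defs.
From HB Require Import structures.
From mathcomp Require Import all_boot all_order all_algebra.
From mathcomp Require Import all_classical all_reals all_analysis.
From mathcomp Require Import measurable_realfun ring lra.
Import Order.TTheory GRing.Theory Num.Theory.
Import numFieldNormedType.Exports.

Set Implicit Arguments.
Unset Strict Implicit.
Unset Printing Implicit Defensive.

Local Open Scope classical_set_scope.
Local Open Scope ring_scope.

(** Let [A] be rigid along [t i].  Two facts make [A] recur along many more
times than the [t i] themselves: if [T (t i)] almost fixes [A], so does
[T (k * t i)] for every [k] below a bound fixed in advance, provided [i] is
large; and an observable that is continuous along orbits barely changes under
[T s] for small [s].  Hence if [r] is a number such that, for a suitable
sequence of integers [N j], each [N j * r] is extremely close to an integer,
then with the times [s j = N j * t (i j)], [r * s j] is an integer multiple of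
[t (i j)] up to a tiny error, so the observable returns along [r * s j].

There are uncountably many such [r]: the sums [sum_k b_k / N (k+1)] with free
binary digits [b_k], where [N j] divides [N (j+1)] and grows as fast as we
please.  Feeding the binary digits of a uniform [u] into this sum
([lacunary_map]) is injective, so it transports Lebesgue measure on the unit
interval to an atomless probability [nu]
([uniform_image_atomless]), and all return estimates hold
uniformly in [r] ([lacunary_return_times]).  For an observable [f] this says
that the average of [f (T (r * s j) x)] over [nu] tends to [f x] in mean,
whereas almost mixing says it tends to the integral of [f]; so [f] is constant
almost everywhere ([rigid_observable_ae_const]).

The indicator of [A] itself is continuous along orbits only in mean.  It is
replaced by the occupation time, the length of the set of [u] in [0, h] with
[T u x] in [A]: it moves by at most [s] under [T s]
([occupation_lipschitz]), and it inherits rigidity from [A] since its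
displacement is at most an occupation time of the symmetric difference of [A]
and its translate ([occupation_symdiff], [integral_occupation]).  If the
occupation times are constant almost everywhere for every [h], then some orbit
spends in [A] a proportion of time equal to the measure of [A] over every
interval [0, h]; by Lebesgue's differentiation theorem the indicator of the set
of visits then equals that constant almost everywhere, which forces the measure
of [A] to be 0 or 1 ([occupation_ae_const01]). *)

(** * Real numbers with prescribed lacunary digits *)

Section lacunary_expansion.
Context (R : realType).

(** The doubling map modulo 1, except that 1 is a fixed point: this keeps the
closed unit interval invariant and gives 1 the digits 1, 1, 1, and so on. *)
Definition doubling (u : R) : R := 2 * u - ((2^-1 : R) <= u)%R%:R.

Definition bit (j : nat) (u : R) : bool := (2^-1 <= iter j doubling u)%R.

Lemma iter_doubling_itv01 (u : R) j :
  0 <= u <= 1 -> 0 <= iter j doubling u <= 1.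
Proof.
move=> u01; elim: j => //= j; set v := iter _ _ _ => v01.
rewrite /doubling; case: (leP 2^-1 v) => /= h; lra.
Qed.

(** While the digits agree, the distance between the orbits of [u] and [v] under
the doubling map doubles at each step, yet both stay in the unit interval. *)
Lemma eq_bits (u v : R) : 0 <= u <= 1 -> 0 <= v <= 1 ->
  (forall j, bit j u = bit j v) -> u = v.
Proof.
move=> u01 v01 uv.
have E j : iter j doubling u - iter j doubling v = (u - v) * 2 ^+ j.
  elim: j => [|j IH]; first by rewrite expr0 mulr1.
  rewrite exprS mulrCA -IH /=.
  have := uv j; rewrite /bit; move: (iter j doubling u) (iter j doubling v).
  by move=> a b; rewrite /doubling => ->; lra.
apply/eqP/contraT => /negPf neq_uv.
have d0 : 0 < `|u - v| by rewrite normr_gt0 subr_eq0 neq_uv.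
pose n := (Num.truncn `|u - v|^-1).+1.
have : `|u - v| * n%:R <= 1.
  have : `|u - v| * 2 ^+ n <= 1.
    rewrite -[2 ^+ n]ger0_norm ?exprn_ge0// -normrM -E.
    have := iter_doubling_itv01 n u01; have := iter_doubling_itv01 n v01.
    rewrite ler_norml; lra.
  apply: le_trans; rewrite ler_pM2l// -natrX ler_nat ltnW//.
  exact: ltn_expl.
by rewrite -ler_pdivlMl// mulr1 leNgt /n truncnS_gt.
Qed.

Lemma measurable_iter_doubling j :
  measurable_fun setT (iter j doubling : R -> R).
Proof.
have md : measurable_fun setT doubling.
  apply: measurable_funB; first exact: measurable_funM.
  rewrite (_ : (fun x : R => _) = \1_`[2^-1, +oo[).
    exact: measurable_indic.
  by apply/funext => x; rewrite indicE mem_setE in_itv/= andbT.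
elim: j => [|j IH]; first exact: measurable_id.
exact: (measurableT_comp md IH).
Qed.

Variable m : nat -> nat.
Hypothesis m_ge3 : forall j, (3 <= m j)%N.

Definition lacunary_den (j : nat) : nat := (\prod_(i < j) m i)%N.

Fixpoint lacunary_num (j : nat) (u : R) : nat :=
  if j is i.+1 then (m i * lacunary_num i u + bit i u)%N else 0%N.

Local Notation N := lacunary_den.
Local Notation K := lacunary_num.

Lemma lacunary_denS j : N j.+1 = (m j * N j)%N.
Proof. by rewrite /N big_ord_recr mulnC. Qed.

Lemma lacunary_den_gt0 j : (0 < N j)%N.
Proof. by apply: prodn_gt0 => i; apply: leq_trans (m_ge3 i). Qed.

Lemma lacunary_num_lt_den j u : (K j u < N j)%N.
Proof.
elim: j => [|j IH]; first by rewrite /N big_ord0.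
rewrite lacunary_denS /=.
apply: (@leq_trans (m j * (K j u).+1)%N); last first.
  by rewrite leq_pmul2l// (leq_trans _ (m_ge3 j)).
by rewrite mulnS addnC ltn_add2r; case: bit => //=; apply: leq_trans (m_ge3 j).
Qed.

Definition lacunary_approx (j : nat) (u : R) : R := (K j u)%:R / (N j)%:R.

Lemma lacunary_approxS j u : lacunary_approx j.+1 u =
  lacunary_approx j u + (bit j u)%:R / (N j.+1)%:R.
Proof.
rewrite /lacunary_approx lacunary_denS /= natrD !natrM mulrDl; congr (_ + _).
rewrite -mulf_div divff ?mul1r// pnatr_eq0 -lt0n.
by apply: leq_trans (m_ge3 j).
Qed.

Lemma lacunary_approx_nd u :
  {homo lacunary_approx ^~ u : i j / (i <= j)%N >-> i <= j}.
Proof.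
apply: homo_leq => //; first by move=> ? ? ?; exact: le_trans.
by move=> j; rewrite lacunary_approxS lerDl divr_ge0.
Qed.

(** All later digits together contribute at most half a unit of the current
precision: with [c] the next unit, the new digit adds at most [c] and the new
half unit is [c / 2], while the old half unit is at least [3 * c / 2]. *)
Lemma lacunary_approx_ni u :
  {homo (fun j => lacunary_approx j u + (2 * (N j)%:R)^-1) :
    i j / (i <= j)%N >-> j <= i}.
Proof.
apply: homo_leq => //; first by move=> ? ? ? ? /le_trans; exact.
move=> j; rewrite lacunary_approxS -addrA lerD2l !invfM.
have Nj : 0 < (N j.+1)%:R^-1 :> R by rewrite invr_gt0 ltr0n lacunary_den_gt0.
have -> : (N j)%:R^-1 = (m j)%:R * (N j.+1)%:R^-1 :> R.
  rewrite lacunary_denS natrM invfM mulrA divff ?mul1r// pnatr_eq0 -lt0n.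
  by apply: leq_trans (m_ge3 j).
have m3 : 3 <= (m j)%:R :> R by rewrite ler_nat.
have : (bit j u)%:R <= 1 :> R by case: bit.
move: (bit j u)%:R (m j)%:R ((N j.+1)%:R^-1) Nj m3 => b a c c0 a3 b1.
rewrite mulrA -mulrDl ler_pM2r//; lra.
Qed.

Definition lacunary_map (u : R) : R := limn (lacunary_approx ^~ u).

Lemma lacunary_approx_cvg u :
  lacunary_approx j u @[j --> \oo] --> lacunary_map u.
Proof.
apply: nondecreasing_is_cvgn; first exact: lacunary_approx_nd.
exists (lacunary_approx 0 u + (2 * (N 0)%:R)^-1) => _ [j _ <-].
apply: le_trans (lacunary_approx_ni u (leq0n j)).
by rewrite lerDl.
Qed.

Lemma measurable_lacunary_map : measurable_fun setT lacunary_map.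
Proof.
apply: (@measurable_fun_cvg _ _ _ _ lacunary_approx) => //; last first.
  by move=> u _; exact: lacunary_approx_cvg.
move=> j; elim: j => [|j IH].
  rewrite (_ : lacunary_approx 0 = cst 0)//.
  by apply/funext => u; rewrite /lacunary_approx /= mul0r.
rewrite (_ : lacunary_approx j.+1 = (fun u => lacunary_approx j u +
  \1_`[2^-1, +oo[ (iter j doubling u) / (N j.+1)%:R)); last first.
  apply/funext => u; rewrite lacunary_approxS; congr (_ + _ / _).
  by rewrite indicE mem_setE in_itv/= andbT.
apply: measurable_funD => //; apply: measurable_funM => //.
apply: measurableT_comp; first exact: measurable_indic.
exact: measurable_iter_doubling.
Qed.

(** This is what the lacunary expansion is for: [N j * lacunary_map u] lies
within [2 / m j] of an integer, and [m j] can be chosen after [N j]. *)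
Lemma lacunary_map_digits j u :
  (K j u)%:R <= (N j)%:R * lacunary_map u <= (K j u)%:R + 2 / (m j)%:R.
Proof.
have N0 : 0 < (N j)%:R :> R by rewrite ltr0n lacunary_den_gt0.
have m0 : 0 < (m j)%:R :> R by rewrite ltr0n (leq_trans _ (m_ge3 j)).
apply/andP; split.
  rewrite -ler_pdivrMl// mulrC.
  apply: (nondecreasing_cvgn_le (lacunary_approx_nd u)).
  exact: lacunary_approx_cvg.
rewrite -ler_pdivlMl//.
apply: (cvgr_to_le (@lacunary_approx_cvg u)).
near=> i.
apply: (@le_trans _ _ (lacunary_approx j.+1 u + (2 * (N j.+1)%:R)^-1)).
  apply: (@le_trans _ _ (lacunary_approx i u + (2 * (N i)%:R)^-1)).
    by rewrite lerDl.
  by apply: lacunary_approx_ni; near: i; exact: nbhs_infty_ge.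
rewrite lacunary_approxS mulrDr -addrA {1}/lacunary_approx mulrC lerD2l.
rewrite lacunary_denS natrM !invfM.
have : (bit j u)%:R <= 1 :> R by case: bit.
have : 0 < (m j)%:R^-1 / (N j)%:R :> R by rewrite divr_gt0// invr_gt0.
rewrite [_^-1 * (2 / _)]mulrC -mulrA.
move: (bit j u)%:R ((m j)%:R^-1 / (N j)%:R) => b c c0 b1.
nra.
Unshelve. all: end_near. Qed.

(** As [2 / m j < 1], the value determines every numerator, hence every
digit. *)
Lemma lacunary_map_inj (u v : R) : 0 <= u <= 1 -> 0 <= v <= 1 ->
  lacunary_map u = lacunary_map v -> u = v.
Proof.
move=> u01 v01 uv.
have leK (a b : R) j : lacunary_map a = lacunary_map b -> (K j a <= K j b)%N.
  move=> ab; have := lacunary_map_digits j a.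
  have := lacunary_map_digits j b; rewrite ab => /andP[_ hb] /andP[ha _].
  rewrite -ltnS -(ltr_nat R) -natr1.
  have : 2 / (m j)%:R < 1 :> R.
    by rewrite ltr_pdivrMr ?ltr0n ?(leq_trans _ (m_ge3 j))// mul1r ltr_nat.
  lra.
have eqK j : K j u = K j v by apply/eqP; rewrite eqn_leq !leK.
apply: eq_bits => // j.
have := eqK j.+1; rewrite /= eqK => /addnI; by do 2 case: bit.
Qed.

End lacunary_expansion.

(** * Return times along lacunary multiples *)

Section return_times.
Context (R : realType).

(** Here [g s] measures how far [T s] moves an observable.  Given [N j], first
choose [i] so that [g (t i)] is small compared with [1 / N j], which controls
all the multiples [k * t i] with [k < N j]; then choose [m j] so large that the
error [2 / m j * t i] left by the later digits is small as well. *)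
Lemma lacunary_return_times (g : R -> R) (C : R) (t : nat -> R) :
  0 <= C ->
  (forall r s, g (r + s) <= g r + g s) ->
  (forall s, 0 <= s -> g s <= C * s) ->
  g (t i) @[i --> \oo] --> 0 -> t i @[i --> \oo] --> +oo ->
  exists m : nat -> nat, (forall j, (3 <= m j)%N) /\
    exists2 s : nat -> R, s j @[j --> \oo] --> +oo &
      forall j u, g (lacunary_map m u * s j) <= j.+1%:R^-1.
Proof.
move=> C0 gD gC gt0 tp.
have gMn r k : g (k%:R * r) <= k%:R * g r.
  elim: k => [|k IH]; first by rewrite !mul0r (le_trans (gC _ _))// mulr0.
  by rewrite -!natr1 !mulrDl !mul1r (le_trans (gD _ _))// lerD2r.
have step (x : nat * nat) : exists y : nat * nat, (0 < x.2)%N ->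
    [/\ (3 <= y.2)%N, x.1.+1%:R <= t y.1,
        x.2%:R * g (t y.1) <= (2 * x.1.+1%:R)^-1 &
        C * (2 / y.2%:R * t y.1) <= (2 * x.1.+1%:R)^-1].
  have [x2|x2] := posnP x.2; first by exists (0, 0)%N; rewrite x2.
  have N0 : 0 < x.2%:R :> R by rewrite ltr0n.
  have e0 : 0 < (2 * x.1.+1%:R)^-1 :> R by rewrite invr_gt0 mulr_gt0.
  have : \forall i \near \oo, x.1.+1%:R <= t i /\
      x.2%:R * g (t i) <= (2 * x.1.+1%:R)^-1.
    near=> i; split; first by near: i; move/cvgryPge : tp; exact.
    rewrite mulrC -ler_pdivlMr//; near: i.
    by apply: (cvgr_le _ gt0); rewrite divr_gt0.
  move=> [i _ /(_ i (leqnn i))[ti gi]].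
  exists (i, (Num.truncn (4 * x.1.+1%:R * C * t i)).+3) => /= _; split => //.
  set M := (_.+3)%:R.
  have M0 : 0 < M :> R by rewrite /M.
  have hM : 4 * x.1.+1%:R * C * t i <= M.
    apply: le_trans (ltW (truncnS_gt _)) _.
    by rewrite ler_nat ltnW// ltnW.
  have -> : C * (2 / M * t i) =
      4 * x.1.+1%:R * C * t i / M * (2 * x.1.+1%:R)^-1.
    by field; rewrite !gt_eqF// ltr0n.
  by rewrite ler_piMl ?(ltW e0)// ler_pdivrMr// mul1r.
have [F FP] := choice step.
pose fix N j := if j is i.+1 then ((F (i, N i)).2 * N i)%N else 1%N.
pose m j := (F (j, N j)).2; pose tt j := t (F (j, N j)).1.
have N_gt0 j : (0 < N j)%N.
  elim: j => //= j IH; rewrite muln_gt0 IH andbT.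
  by have [+ _ _ _] := FP (j, N j) IH; apply: leq_trans.
have m3 j : (3 <= m j)%N by have [] := FP (j, N j) (N_gt0 j).
have NE j : N j = lacunary_den m j.
  elim: j => [|j IH]; first by rewrite /lacunary_den big_ord0.
  by rewrite lacunary_denS// -IH.
exists m; split => //; exists (fun j => (N j)%:R * tt j).
  apply: ger_cvgy (@cvgr_idn R); near=> j.
  have [_ /= h _ _] := FP (j, N j) (N_gt0 j).
  have h' : j%:R <= tt j by rewrite (le_trans _ h)// ler_nat.
  rewrite (le_trans h')// ler_peMl ?ler1n// (le_trans _ h')//.
move=> j u.
have [_ /= tj gj Cj] := FP (j, N j) (N_gt0 j).
rewrite -/(m j) -/(tt j) in tj gj Cj.
have t0 : 0 <= tt j by apply: le_trans tj.
have := lacunary_map_digits m3 j u; have := lacunary_num_lt_den m3 j u.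
rewrite -NE; move: (lacunary_num m j u) => k kN /andP[k1 k2].
rewrite mulrA [_ * (N j)%:R]mulrC.
rewrite (_ : _ * tt j = k%:R * tt j +
  ((N j)%:R * lacunary_map m u - k%:R) * tt j); last first.
  by rewrite -mulrDl addrC subrK.
apply: le_trans (gD _ _) _.
have -> : j.+1%:R^-1 = (2 * j.+1%:R)^-1 + (2 * j.+1%:R)^-1 :> R.
  by rewrite invfM -mulrDl -[2^-1]div1r -splitr mul1r.
apply: lerD.
  apply: le_trans (gMn _ _) _.
  have [g0|/ltW g0] := leP (g (tt j)) 0.
    by rewrite (@le_trans _ _ 0)// ?mulr_ge0_le0// invr_ge0 mulr_ge0.
  by apply: le_trans gj; rewrite ler_wpM2r// ler_nat ltnW.
apply: le_trans (gC _ _) _; first by rewrite mulr_ge0// subr_ge0.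
apply: le_trans Cj; rewrite ler_wpM2l// ler_wpM2r//; lra.
Unshelve. all: end_near. Qed.

(** The image of the uniform distribution on the unit interval: fibres of [psi]
meet that interval in at most one point, so they are null.  The bound on
integrals expresses that the image is carried by the range of [psi], without
requiring that range to be measurable. *)
Lemma uniform_image_atomless (psi : R -> R)
    (mpsi : measurable_fun setT
      (psi : measurableTypeR R -> measurableTypeR R)) :
  (forall u v, 0 <= u <= 1 -> 0 <= v <= 1 -> psi u = psi v -> u = v) ->
  exists2 nu : probability (measurableTypeR R) R, atomless nu &
    forall f : measurableTypeR R -> \bar R,
      measurable_fun setT f -> (forall r, 0 <= f r)%E ->
      forall c, (forall u, f (psi u) <= c)%E -> (\int[nu]_r f r <= c)%E.
Proof.
move=> inj.
have mA r : measurable (psi @^-1` [set r] : set (measurableTypeR R)).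
  by rewrite -[X in measurable X]setTI; apply: mpsi.
pose P : probability (measurableTypeR R) R := uniform_prob (@ltr01 R).
pose psi' : {mfun measurableTypeR R >-> measurableTypeR R} :=
  HB.pack (psi : measurableTypeR R -> measurableTypeR R)
    (isMeasurableFun.Build _ _ _ _ _ mpsi).
exists (distribution P psi').
  move=> r; rewrite /distribution /pushforward.
  change (uniform_prob (@ltr01 R) (psi' @^-1` [set r]) = 0%E).
  rewrite /uniform_prob integral_uniform_pdf.
  apply: null_set_integral.
  - exact: measurableI.
  - apply/measurable_EFinP/measurable_funTS; exact: measurable_uniform_pdf.
  have [->|/set0P[v [/= pv v01]]] :=
    eqVneq (psi' @^-1` [set r] `&` `[0, 1]) set0.
    by rewrite measure0.
  apply/eqP; rewrite -measure_le0 -(lebesgue_measure_set1 v).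
  apply: le_measure; rewrite ?inE//; first exact: measurableI.
  move=> u [/= pu u01]; apply: inj; last by rewrite pu pv.
    by move: u01; rewrite in_itv.
  by move: v01; rewrite in_itv.
move=> f mf f0 c fc.
rewrite ge0_integral_distribution//.
apply: (@le_trans _ _ (\int[P]_x cst c x)%E).
  apply: ge0_le_integral => //.
  - by move=> u _ /=.
  - exact: (measurableT_comp mf mpsi).
  - by move=> u _; exact: fc.
by rewrite integral_cst//= probability_setT mule1.
Qed.

End return_times.

(** * Occupation times *)

Section translation.
Context (R : realType).

Lemma lebesgue_measure_translation (s : R) (B : set (measurableTypeR R)) :
  measurable B ->
  lebesgue_measure ((fun u : R => u + s) @^-1` B : set (measurableTypeR R)) =
  lebesgue_measure B.
Proof.
move=> mB.
have ms : measurable_fun setT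
    ((fun u => u + s) : measurableTypeR R -> measurableTypeR R).
  exact: measurable_funD.
rewrite -[LHS]/(pushforward lebesgue_measure
  ((fun u => u + s) : measurableTypeR R -> measurableTypeR R) B).
apply/esym/lebesgue_measure_unique => //= _ [[a b]] _ <-.
rewrite /pushforward /=.
rewrite (_ : _ @^-1` _ = `]a - s, b - s]%classic); last first.
  by apply/seteqP; split => u; rewrite /= !in_itv/= ltrBlDr lerBrDr.
rewrite !lebesgue_measure_itv/= !lte_fin ltrD2r; case: ifPn => // _.
by rewrite -!EFinB opprB addrA subrK.
Qed.

Lemma lebesgue_measure_itvcc (a b : R) :
  lebesgue_measure (`[a, b]%classic : set (measurableTypeR R)) =
  (Num.max (b - a) 0)%:E.
Proof.
have -> := lebesgue_measure_itv `[a, b]; rewrite /= lte_fin.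
case: ltP => ab; first by rewrite -EFinB max_l// subr_ge0 ltW.
by rewrite max_r// subr_le0.
Qed.

End translation.

Lemma fine_measure_leU d (T : measurableType d) (R : realType)
    (mu : {measure set T -> \bar R}) (A B C : set T) :
  measurable A -> measurable B -> measurable C ->
  (mu B < +oo)%E -> (mu C < +oo)%E -> A `<=` B `|` C ->
  fine (mu A) <= fine (mu B) + fine (mu C).
Proof.
move=> mA mB mC Boo Coo ABC.
have fB : mu B \is a fin_num by rewrite ge0_fin_numE.
have fC : mu C \is a fin_num by rewrite ge0_fin_numE.
have ABC' : (mu A <= mu B + mu C)%E.
  apply: (@le_trans _ _ (mu (B `|` C))); last exact: measureU2.
  by apply: le_measure => //; rewrite inE//; exact: measurableU.
have fA : mu A \is a fin_num.
  by rewrite ge0_fin_numE// (le_lt_trans ABC')// lte_add_pinfty.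
by rewrite -lee_fin EFinD !fineK.
Qed.

Section occupation_time.
Context (R : realType) (d : measure_display) (X : measurableType d).
Variables (mu : probability X R) (T : R -> X -> X).
Hypothesis flowT : measure_preserving_flow mu T.

Lemma measurable_flow t : measurable_fun setT (T t).
Proof.
exact: (measurableT_comp (flow_measurable flowT) (pair1_measurable t)).
Qed.

Lemma measurable_flow_preimage t (A : set X) :
  measurable A -> measurable (T t @^-1` A).
Proof.
by move=> mA; rewrite -[X in measurable X]setTI; exact: measurable_flow.
Qed.

Lemma ge0_integral_flow t (f : X -> \bar R) :
  measurable_fun setT f -> (forall x, 0 <= f x)%E ->
  (\int[mu]_x f (T t x) = \int[mu]_x f x)%E.
Proof.
move=> mf f0.
have mT := measurable_flow t.
rewrite -(@ge0_integral_pushforward _ _ _ _ R (T t) mT mu setT f)//.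
apply: eq_measure_integral => A mA _.
exact: flow_preserving.
Qed.

Definition visits (A : set X) (x : X) : set (measurableTypeR R) :=
  [set u | A (T u x)].

Definition occupation (A : set X) (h : R) (x : X) : R :=
  fine (lebesgue_measure (visits A x `&` `[0, h]%classic)).

Lemma measurable_visits A x : measurable A -> measurable (visits A x).
Proof.
move=> mA; rewrite -[X in measurable X]setTI.
exact: (measurableT_comp (flow_measurable flowT) (pair2_measurable x)
  measurableT mA).
Qed.

Lemma visits_flow A s x :
  visits A (T s x) = (fun u : R => u + s) @^-1` visits A x.
Proof. by apply/seteqP; split => u; rewrite /visits /= (flowD flowT). Qed.

Lemma lebesgue_visits_itvcc_lty A x a b :
  measurable A -> (lebesgue_measure (visits A x `&` `[a, b]) < +oo)%E.
Proof.
move=> mA; apply: le_lt_trans (measureIr _ _ _) _ => //.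
  exact: measurable_visits.
by rewrite [ltLHS]lebesgue_measure_itvcc ltry.
Qed.

Lemma occupationE A h x : measurable A ->
  (occupation A h x)%:E = lebesgue_measure (visits A x `&` `[0, h]%classic).
Proof.
by move=> mA; rewrite fineK// ge0_fin_numE// lebesgue_visits_itvcc_lty.
Qed.

Lemma occupation_ge0 A h x : 0 <= occupation A h x.
Proof. exact: fine_ge0. Qed.

Lemma occupation_le A h x : measurable A -> 0 <= h -> occupation A h x <= h.
Proof.
move=> mA h0; rewrite -lee_fin occupationE//.
apply: le_trans (measureIr _ _ _) _ => //; first exact: measurable_visits.
by rewrite [leLHS]lebesgue_measure_itvcc subr0 max_l.
Qed.

(** Occupation times are the lengths of the sections of [slab A h] at fixed
[x], which gives their measurability, and their integral by exchanging the two
kinds of sections. *)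
Let slab (A : set X) (h : R) : set (measurableTypeR R * X) :=
  [set p | A (T p.1 p.2)] `&` (`[0, h] `*` setT).

Let measurable_slab A h : measurable A -> measurable (slab A h).
Proof.
move=> mA; apply: measurableI; last exact: measurableX.
rewrite -[X in measurable X]setTI.
exact: (flow_measurable flowT measurableT mA).
Qed.

Let ysection_slab A h x : ysection (slab A h) x = visits A x `&` `[0, h].
Proof.
apply/seteqP; split => u; rewrite /ysection/= inE.
  by case=> /= ? [].
by case=> /= ? ?; split.
Qed.

Lemma measurable_occupation A h : measurable A ->
  measurable_fun setT (occupation A h).
Proof.
move=> mA; apply/measurable_EFinP.
have := measurable_fun_ysection (@lebesgue_measure R) (measurable_slab h mA).
congr (measurable_fun _ _); apply/funext => x /=.
by rewrite occupationE// ysection_slab.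
Qed.

(** At each time [u] in [0, h] the set of [x] with [T u x] in [A] has the
measure of [A]. *)
Lemma integral_occupation A h : measurable A -> 0 <= h ->
  (\int[mu]_x (occupation A h x)%:E = h%:E * mu A)%E.
Proof.
move=> mA h0.
have := indic_fubini_tonelli (@lebesgue_measure R) mu (measurable_slab h mA).
rewrite indic_fubini_tonelli_FE ?indic_fubini_tonelli_GE;
  try exact: measurable_slab.
move=> E.
transitivity (\int[mu]_x (lebesgue_measure \o ysection (slab A h)) x)%E.
  by apply: eq_integral => x _ /=; rewrite occupationE// ysection_slab.
rewrite -E (_ : mu \o _ =
    fun u => (mu A * (\1_(`[0, h]%classic : set R) u)%:E)%E).
  rewrite ge0_integralZl//; last first.
    by apply/measurable_EFinP; exact: measurable_indic.
  rewrite integral_indic// setIT muleC; congr (_ * _)%E.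
  by rewrite [LHS]lebesgue_measure_itvcc subr0 max_l.
apply/funext => u /=; rewrite indicE.
have [u0|u0] := boolP (u \in _); last first.
  rewrite mule0 (_ : xsection _ _ = set0) ?measure0//.
  apply/seteqP; split => x //; rewrite /xsection/= inE => -[_ [/= + _]].
  by move: u0; rewrite notin_setE.
rewrite mule1 -(flow_preserving flowT u mA); congr (mu _).
apply/seteqP; split => x; rewrite /xsection/= inE; first by case.
by move=> ?; split => //; split => //=; rewrite inE in u0.
Qed.

(** Starting at [T s x] replaces the window [0, h] by [s, h + s]; the windows
differ by two intervals of length [s], one lost and one gained. *)
Lemma occupation_lipschitz A h x s : measurable A -> 0 <= h -> 0 <= s ->
  `|occupation A h (T s x) - occupation A h x| <= s.
Proof.
move=> mA h0 s0.
have mV := measurable_visits x mA.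
pose I (a b : R) : set (measurableTypeR R) := `[a, b]%classic.
have mI a b : measurable (I a b) by exact: measurable_itv.
have len (a b : R) : a <= b -> fine (lebesgue_measure (I a b)) = b - a.
  move=> ab; rewrite lebesgue_measure_itv/= lte_fin; case: ltP => //= ba.
  by apply/esym/eqP; rewrite subr_eq0 eq_le ba ab.
have lty (a b : R) : (lebesgue_measure (I a b) < +oo)%E.
  by rewrite lebesgue_measure_itvcc ltry.
have -> : occupation A h (T s x) =
    fine (lebesgue_measure (visits A x `&` `[s, h + s]%classic)).
  rewrite /occupation visits_flow.
  rewrite -[in RHS](@lebesgue_measure_translation _ s); last first.
    exact: measurableI.
  congr (fine (lebesgue_measure _)); apply/seteqP; split => u [Au] /=;
    rewrite ?in_itv/= => u0h; split => //=; lra.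
set P := fine _.
have lo : occupation A h x <= P + fine (lebesgue_measure (I 0 s)).
  apply: (@fine_measure_leU _ _ _ lebesgue_measure) => //;
    try exact: measurableI; try exact: lebesgue_visits_itvcc_lty;
    try exact: mI; try exact: lty.
  move=> u [Au]; rewrite /I/= ?in_itv/= => u0h.
  have [us|us] := leP u s; [right|left; split] => //=;
    rewrite /I/= ?in_itv/=; lra.
have hi : P <= occupation A h x + fine (lebesgue_measure (I h (h + s))).
  apply: (@fine_measure_leU _ _ _ lebesgue_measure) => //;
    try exact: measurableI; try exact: lebesgue_visits_itvcc_lty;
    try exact: mI; try exact: lty.
  move=> u [Au]; rewrite /I/= ?in_itv/= => u0h.
  have [us|us] := leP u h; [left; split|right] => //=;
    rewrite /I/= ?in_itv/=; lra.
have hhs : h <= h + s by rewrite lerDl.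
rewrite !len// in lo hi; rewrite ler_norml; lra.
Qed.

(** The sets of visits of [x] and of [T t x] to [A] differ exactly at the visits
of [x] to the symmetric difference of [A] and its preimage. *)
Lemma occupation_symdiff A h x t : measurable A -> 0 <= h ->
  `|occupation A h (T t x) - occupation A h x| <=
  occupation ((A `\` T t @^-1` A) `|` (T t @^-1` A `\` A)) h x.
Proof.
move=> mA h0.
have mTA := measurable_flow_preimage t mA.
have mD : measurable ((A `\` T t @^-1` A) `|` (T t @^-1` A `\` A)).
  by apply: measurableU; exact: measurableD.
have comm u y : T u (T t y) = T t (T u y).
  by rewrite -!(flowD flowT) addrC.
rewrite ler_norml lerBlDl lerNl opprB lerBlDl; apply/andP; split.
  apply: fine_measure_leU;
    try (by apply: measurableI => //; exact: measurable_visits);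
    try exact: lebesgue_visits_itvcc_lty.
  move=> u [Au u0h]; have [ATu|ATu] := pselect (visits A (T t x) u).
    by left.
  by right; split => //; left; split => //=; rewrite -comm.
apply: fine_measure_leU;
  try (by apply: measurableI => //; exact: measurable_visits);
  try exact: lebesgue_visits_itvcc_lty.
move=> u [Au u0h]; have [ATu|ATu] := pselect (visits A x u); first by left.
by right; split => //; right; split => //=; rewrite -comm.
Qed.

End occupation_time.

(** * Rigid observables of an almost mixing flow are constant *)

Section displacement.
Context (R : realType) (d : measure_display) (X : measurableType d).
Variables (mu : probability X R) (T : R -> X -> X).
Hypothesis flowT : measure_preserving_flow mu T.
Variables (f : X -> R) (M : R).
Hypothesis mf : measurable_fun setT f.
Hypothesis f_bnd : forall x, 0 <= f x <= M.

Definition displacement (s : R) : R :=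
  fine (\int[mu]_x `|f (T s x) - f x|%:E).

Let M_ge0 : 0 <= M.
Proof. by have /andP[] := f_bnd point; exact: le_trans. Qed.

Let mdiff (s : R) :
  measurable_fun setT (fun x => (`|f (T s x) - f x|)%:E).
Proof.
apply/measurable_EFinP/measurableT_comp => //; apply: measurable_funB => //.
by apply: measurableT_comp => //; exact: (measurable_flow flowT).
Qed.

Let dist_le x y : `|f y - f x| <= M.
Proof. have := f_bnd x; have := f_bnd y; rewrite ler_norml; lra. Qed.

Lemma displacementE s :
  (displacement s)%:E = (\int[mu]_x (`|f (T s x) - f x|)%:E)%E.
Proof.
rewrite fineK// ge0_fin_numE; last first.
  by apply: integral_ge0 => x _; rewrite lee_fin.
apply: (@le_lt_trans _ _ (\int[mu]_x (cst M%:E) x)%E).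
  by apply: ge0_le_integral => //; move=> x _; rewrite lee_fin dist_le.
by rewrite integral_cst//= probability_setT mule1 ltry.
Qed.

Lemma displacementD r s :
  displacement (r + s) <= displacement r + displacement s.
Proof.
rewrite -lee_fin EFinD !displacementE.
have -> : (\int[mu]_x (`|f (T r x) - f x|)%:E =
    \int[mu]_x (`|f (T r (T s x)) - f (T s x)|)%:E)%E.
  by rewrite -(ge0_integral_flow flowT s (mdiff r)).
rewrite -ge0_integralD//; last first.
  by apply: (measurableT_comp (mdiff r)); exact: (measurable_flow flowT).
apply: ge0_le_integral => //.
- apply: emeasurable_funD => //; apply: (measurableT_comp (mdiff r)).
  exact: (measurable_flow flowT).
- move=> x _; rewrite -EFinD lee_fin (flowD flowT).
  by rewrite (le_trans _ (ler_normD _ _))// addrA subrK.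
Qed.

Lemma displacement_le C s :
  (forall x, `|f (T s x) - f x| <= C) -> displacement s <= C.
Proof.
move=> hC; rewrite -lee_fin displacementE.
apply: (@le_trans _ _ (\int[mu]_x (cst C%:E) x)%E).
  by apply: ge0_le_integral => //; move=> x _; rewrite lee_fin.
by rewrite integral_cst//= probability_setT mule1.
Qed.

Let measurable_orbit : measurable_fun setT
  (fun p : measurableTypeR R * X => (f (T p.1 p.2))%:E).
Proof.
apply/measurable_EFinP/measurableT_comp => //; exact: (flow_measurable flowT).
Qed.

Let measurable_orbit_dist : measurable_fun setT
  (fun p : measurableTypeR R * X => (`|f (T p.1 p.2) - f p.2|)%:E).
Proof.
apply/measurable_EFinP/measurableT_comp => //; apply: measurable_funB.
  exact/measurable_EFinP.
exact: measurableT_comp.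
Qed.

Let measurable_fun_dilation (g : measurableTypeR R * X -> \bar R) (s : R) :
  measurable_fun setT g -> measurable_fun setT
    (fun p : measurableTypeR R * X => g (p.1 * s, p.2)).
Proof.
move=> mg.
have ms : measurable_fun setT
    ((fun r => r * s) : measurableTypeR R -> measurableTypeR R).
  exact: measurable_funM.
apply: (measurableT_comp mg).
by apply: measurable_fun_pair => //; exact: (measurableT_comp ms).
Qed.

Lemma measurable_displacement s : measurable_fun setT
  (fun r : measurableTypeR R => (displacement (r * s))%:E).
Proof.
under eq_fun do rewrite displacementE.
apply: (measurable_fun_fubini_tonelli_F
  (fun p : measurableTypeR R * X => (`|f (T (p.1 * s) p.2) - f p.2|)%:E)).
- exact: (measurable_fun_dilation s measurable_orbit_dist).
- by move=> p; rewrite lee_fin.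
Qed.

Let c_fin : (\int[mu]_y (f y)%:E)%E \is a fin_num.
Proof.
rewrite ge0_fin_numE; last first.
  by apply: integral_ge0 => x _; rewrite lee_fin; case/andP: (f_bnd x).
apply: (@le_lt_trans _ _ (\int[mu]_x (cst M%:E) x)%E).
  apply: ge0_le_integral => //.
  - by move=> x _; rewrite lee_fin; case/andP: (f_bnd x).
  - exact/measurable_EFinP.
  - by move=> x _; rewrite lee_fin; case/andP: (f_bnd x).
by rewrite integral_cst//= probability_setT mule1 ltry.
Qed.

(** The triangle inequality through the average of [f (T (r * s) x)] over
[nu], whose distance to [f x] is integrated over [x] first. *)
Lemma mean_displacement_le (nu : probability (measurableTypeR R) R) (s : R) :
  (\int[mu]_x `|(f x)%:E - \int[mu]_y (f y)%:E| <=
   'N[mu]_1[(fun x => (\int[nu]_r (f (T (r * s) x))%:E)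
                        - (\int[mu]_y (f y)%:E))] +
   \int[nu]_r (displacement (r * s))%:E)%E.
Proof.
have mF := measurable_fun_dilation s measurable_orbit.
have mD := measurable_fun_dilation s measurable_orbit_dist.
have -> : (\int[nu]_r (displacement (r * s))%:E =
    \int[mu]_x \int[nu]_r (`|f (T (r * s) x) - f x|)%:E)%E.
  under eq_integral do rewrite displacementE.
  by rewrite (fubini_tonelli
    (fun p : measurableTypeR R * X => (`|f (T (p.1 * s) p.2) - f p.2|)%:E)).
have mG : measurable_fun setT (fun x => \int[nu]_r (f (T (r * s) x))%:E)%E.
  apply: (measurable_fun_fubini_tonelli_G _ mF) => p.
  by rewrite lee_fin; have /andP[] := f_bnd (T (p.1 * s) p.2).
have mH : measurable_fun setT
    (fun x => \int[nu]_r (`|f (T (r * s) x) - f x|)%:E)%E.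
  exact: (measurable_fun_fubini_tonelli_G _ mD).
rewrite Lnorm1 -ge0_integralD//; last 2 first.
- by apply: measurableT_comp => //; exact: emeasurable_funB.
- by move=> x _; apply: integral_ge0.
have nuf x : nu.-integrable setT (fun r => (f (T (r * s) x))%:E).
  apply: (@le_integrable _ _ _ nu setT _ _ (EFin \o cst M)) => //.
  - exact: (measurableT_comp mF (pair2_measurable x)).
  - move=> r _; rewrite lee_fin.
    by rewrite !ger0_norm//; case/andP: (f_bnd (T (r * s) x)).
  - exact: finite_measure_integrable_cst.
apply: ge0_le_integral => //.
- apply: measurableT_comp => //; apply: emeasurable_funB => //.
  exact/measurable_EFinP.
- apply: emeasurable_funD => //; apply: measurableT_comp => //.
  exact: emeasurable_funB.
move=> x _.
have nuc : nu.-integrable setT (fun r => (f x)%:E).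
  exact: finite_measure_integrable_cst.
have Ifin : (\int[nu]_r (f (T (r * s) x))%:E)%E \is a fin_num.
  exact: integrable_fin_num.
have nuB : (\int[nu]_r ((f (T (r * s) x))%:E - (f x)%:E) =
    \int[nu]_r (f (T (r * s) x))%:E - (f x)%:E)%E.
  have nu_c : (\int[nu]_r (cst (f x)%:E) r = (f x)%:E)%E.
    by rewrite integral_cst//= probability_setT mule1.
  rewrite -[in RHS]nu_c; exact: (integralB measurableT (nuf x) nuc).
have -> : ((f x)%:E - \int[mu]_y (f y)%:E =
  (\int[nu]_r (f (T (r * s) x))%:E - \int[mu]_y (f y)%:E) -
  \int[nu]_r ((f (T (r * s) x))%:E - (f x)%:E))%E.
  rewrite nuB.
  rewrite -(fineK Ifin) -(fineK c_fin) -!EFinB; congr (_%:E); lra.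
apply: le_trans (lee_abs_sub _ _) _.
rewrite leeD2l//; apply: le_trans (le_abse_integral _ _ _) _ => //.
apply: emeasurable_funB => //.
exact: (measurableT_comp mF (pair2_measurable x)).
Qed.

(** Along the return times [s j] attached to [f], both terms bounding the mean
distance from [f] to its integral vanish in the limit: the first by almost
mixing, the second because [displacement (r * s j)] is uniformly small on the
range of the lacunary map. *)
Lemma rigid_observable_ae_const (C : R) (t : nat -> R) :
  0 <= C ->
  (forall s x, 0 <= s -> `|f (T s x) - f x| <= C * s) ->
  displacement (t i) @[i --> \oo] --> 0 -> t i @[i --> \oo] --> +oo ->
  almost_mixing mu T ->
  {ae mu, forall x, (f x)%:E = \int[mu]_y (f y)%:E}%E.
Proof.
move=> C0 fC dt tp [_ mix].
have dC s : 0 <= s -> displacement s <= C * s.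
  by move=> s0; apply: displacement_le => x; exact: fC.
have [m [m3 [s sp ms]]] := lacunary_return_times C0 displacementD dC dt tp.
have [nu nu_atomless nu_le] := @uniform_image_atomless R
  (lacunary_map m) (measurable_lacunary_map m3) (lacunary_map_inj m3).
have fL : f \in Lfun mu 1%E.
  rewrite inE/=; apply/andP; split; first by rewrite inE.
  rewrite inE/= /finite_norm Lnorm1.
  apply: (@le_lt_trans _ _ (\int[mu]_x (cst M%:E) x)%E); last first.
    by rewrite integral_cst//= probability_setT mule1 ltry.
  apply: ge0_le_integral => //.
  - by apply: measurableT_comp => //; exact/measurable_EFinP.
  - by move=> x _ /=; rewrite lee_fin ger0_norm; case/andP: (f_bnd x).
have {}mix := mix nu nu_atomless f fL.
set c := (\int[mu]_y (f y)%:E)%E in mix *.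
have J0 : (\int[mu]_x `|(f x)%:E - c| = 0)%E.
  apply/eqP; rewrite eq_le integral_ge0// andbT.
  have mixs := cvg_comp _ _ sp mix.
  have lim0 : (((j.+1%:R^-1 : R)%:E) @[j --> \oo] --> 0%E)%E.
    by apply: cvg_EFin; [exact: nearW|exact: cvg_harmonic].
  have := cvgeD _ mixs lim0; rewrite adde0 => /(_ _ isT) cv.
  apply: (@cvge_to_ge _ _ _ _ _ _ _ cv).
  apply: nearW => j /=.
  apply: le_trans (mean_displacement_le nu (s j)) _.
  rewrite leeD2l//; apply: nu_le.
  - exact: measurable_displacement.
  - move=> r; rewrite lee_fin; apply: fine_ge0.
    by apply: integral_ge0 => x _; rewrite lee_fin.
  - by move=> u; rewrite lee_fin.
have mfc : measurable_fun setT (fun x => (f x)%:E - c)%E.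
  by apply: emeasurable_funB => //; exact/measurable_EFinP.
move/(ae_eq_integral_abs mu measurableT mfc) : J0.
apply: filterS => x /= /(_ I).
by rewrite /c -(fineK c_fin) -EFinB => /eqP; rewrite eqe subr_eq0 => /eqP ->.
Qed.

End displacement.

(** * Occupation times of a rigid set *)

Section rigid_factor.
Context (R : realType) (d : measure_display) (X : measurableType d).
Variables (mu : probability X R) (T : R -> X -> X).
Hypothesis flowT : measure_preserving_flow mu T.
Local Notation lambda := (@lebesgue_measure R).

(** The primitive of the indicator of [E] is linear with slope [c], while its
derivative is almost everywhere a value of the indicator. *)
Lemma proportional_density01 (E : set (measurableTypeR R)) (c : R) :
  measurable E ->
  (forall y, 0 < y -> fine (lambda (E `&` `[0, y]%classic)) = y * c) ->
  c = 0 \/ c = 1.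
Proof.
move=> mE Ec.
have int_E y : lambda.-integrable `[0, y]%classic (EFin \o (\1_E : R -> R)).
  apply/integrableP; split.
    by apply/measurable_EFinP; exact: measurable_funTS.
  rewrite (eq_integral (fun u => (\1_E u)%:E)) => [|u _]; last first.
    by rewrite /= ger0_norm.
  rewrite integral_indic//; apply: le_lt_trans (measureIr _ _ _) _ => //.
  by rewrite [ltLHS]lebesgue_measure_itvcc ltry.
have := @FTC1 R (\1_E : R -> R) (BLeft 0) int_E
  (locally_integrable_indic openT mE).
set F := fun x : R => _.
have FE y : 0 < y -> F y = y * c.
  move=> y0; rewrite -(Ec _ y0) /F /Rintegral integral_indic//.
case=> N [mN N0 hN].
have [u [u0 u1 Fu]] : exists u,
    [/\ 0 < u, u < 1 & derivable F u 1 /\ derive1 F u = \1_E u].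
  apply: contrapT => hu.
  have : (lambda `]0%R, 1%R[%classic <= lambda N)%E.
    apply: le_measure; rewrite ?inE// => u /=; rewrite in_itv/= => /andP[u0 u1].
    apply: hN => /= hFu; apply: hu; exists u; split => //; apply: hFu.
    by rewrite lte_fin.
  have -> := lebesgue_measure_itv `]0, 1[.
  by rewrite N0 /= lte_fin ltr01 oppr0 adde0 lee_fin ler10.
have : derive1 F u = c.
  rewrite derive1E.
  rewrite (@near_eq_derive _ _ _ F (fun y => y * c)).
  - have dc : is_derive u (1 : R) (fun y : R => y * c) c.
      by apply: is_derive_eq; rewrite scaler0 add0r /GRing.scale/= mulr1.
    by rewrite derive_val.
  - by near=> y; apply: FE; near: y; exact: lt_nbhsr.
case: Fu => _; rewrite /derive1 => ->; rewrite indicE.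
by case: (_ \in _) => <-; [right|left].
Unshelve. all: by end_near. Qed.

(** Choose one [x] that is generic for all positive rational [h] at once; since
occupation times are monotone in [h], the proportion of visits of this [x] is
then right for every real [h]. *)
Lemma occupation_ae_const01 (A : set X) : measurable A ->
  (forall h, 0 < h ->
    {ae mu, forall x, (occupation T A h x)%:E = h%:E * mu A}%E) ->
  mu A = 0%E \/ mu A = 1%E.
Proof.
move=> mA occA.
pose q n : R := ratr (odflt 0%Q (unpickle n)).
have : {ae mu, forall x, forall n, 0 < q n ->
    (occupation T A (q n) x)%:E = ((q n)%:E * mu A)%E}.
  apply/ae_foralln => n; have [q0|q0] := ltP 0 (q n).
    by apply: filterS (occA _ q0) => x.
  by apply: nearW.
have muT : (0 < mu setT)%E by rewrite probability_setT.
have aeP := ae_properfilter_algebraOfSetsType muT.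
move=> /filter_ex [x Hx].
have Afin : mu A \is a fin_num by exact: fin_num_measure.
set c := fine (mu A).
have occ_rat (p : rat) : 0 < ratr p :> R ->
    occupation T A (ratr p) x = ratr p * c.
  move=> p0; have := Hx (pickle p); rewrite /q pickleK/= => /(_ p0).
  by rewrite -(fineK Afin) -EFinM => -[].
have occ_nd y z : y <= z -> occupation T A y x <= occupation T A z x.
  move=> yz; rewrite -lee_fin !(occupationE flowT)//.
  apply: le_measure; rewrite ?inE.
  - apply: measurableI => //; exact: (measurable_visits flowT).
  - apply: measurableI => //; exact: (measurable_visits flowT).
  - apply: setIS => u /=; rewrite !in_itv/= => /andP[-> /le_trans]; exact.
have c0 : 0 <= c by exact: fine_ge0.
have occ_real y : 0 < y -> occupation T A y x = y * c.
  move=> y0; apply/eqP; rewrite eq_le.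
  apply/andP; split; rewrite leNgt; apply/negP => hy.
    have : exists2 q : rat, y < ratr q & ratr q * c < occupation T A y x.
      have [c00|cn0] := eqVneq c 0.
        have [r] : exists r : rat, ratr r \in `]y, y + 1[.
          by apply: rat_in_itvoo; rewrite ltrDl.
        rewrite in_itv/= => /andP[yr _]; exists r => //.
        by rewrite c00 mulr0; rewrite c00 mulr0 in hy.
      have cp : 0 < c by rewrite lt_neqAle eq_sym cn0.
      have [r] : exists r : rat, ratr r \in `]y, occupation T A y x / c[.
        by apply: rat_in_itvoo; rewrite ltr_pdivlMr.
      by rewrite in_itv/= => /andP[yr rc]; exists r => //; rewrite -ltr_pdivlMr.
    move=> [r yr]; rewrite -occ_rat ?(lt_trans y0)//; apply/negP.
    rewrite -leNgt.
    exact/occ_nd/ltW.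
  have cp : 0 < c.
    rewrite lt_neqAle c0 andbT eq_sym; apply/negP => /eqP c00.
    by move: hy; rewrite c00 mulr0 ltNge occupation_ge0.
  have [r] : exists r : rat, ratr r \in `]occupation T A y x / c, y[.
    by apply: rat_in_itvoo; rewrite ltr_pdivrMr.
  rewrite in_itv/= => /andP[rc ry].
  have r0 : 0 < ratr r :> R.
    by rewrite (le_lt_trans _ rc)// divr_ge0// occupation_ge0.
  move: rc; rewrite ltr_pdivrMr// -occ_rat//; apply/negP; rewrite -leNgt.
  exact/occ_nd/ltW.
have [c0'|c1] := proportional_density01 (measurable_visits flowT x mA) occ_real.
  by left; rewrite -(fineK Afin) -/c c0'.
by right; rewrite -(fineK Afin) -/c c1.
Qed.

(** [A] and its image under [T s] meet in a translate of the intersection of [A]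
with its preimage, so both halves of the symmetric difference have measure
[mu A - mu (A `&` T s @` A)]. *)
Lemma rigid_symdiff_cvg (A : set X) (t : nat -> R) : measurable A ->
  (mu (A `&` T (t i) @` A) @[i --> \oo] --> mu A)%E ->
  fine (mu ((A `\` T (t i) @^-1` A) `|` (T (t i) @^-1` A `\` A)))
    @[i --> \oo] --> 0.
Proof.
move=> mA cvA.
have mTA s : measurable (T s @^-1` A).
  exact: (measurable_flow_preimage flowT).
have TN s x : T (- s) (T s x) = x.
  by rewrite -(flowD flowT) addNr (flow0 flowT).
have TN' s x : T s (T (- s) x) = x.
  by rewrite -(flowD flowT) addrN (flow0 flowT).
have imE s : A `&` T s @` A = T (- s) @^-1` (A `&` T s @^-1` A).
  apply/seteqP; split => x.
    by move=> [Ax [y Ay yx]]; rewrite -yx in Ax *; split => /=; rewrite TN.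
  move=> [/= ANx]; rewrite TN' => Ax; split => //.
  by exists (T (- s) x).
have fin B : measurable B -> mu B \is a fin_num.
  by move=> ?; exact: fin_num_measure.
have imEmu s : mu (A `&` T s @` A) = mu (A `&` T s @^-1` A).
  by rewrite imE (flow_preserving flowT)//; exact: measurableI.
have bound s : fine (mu ((A `\` T s @^-1` A) `|` (T s @^-1` A `\` A))) <=
    (fine (mu A) - fine (mu (A `&` T s @` A))) *+ 2.
  rewrite mulr2n -lee_fin EFinD !EFinB imEmu.
  rewrite !fineK; try (apply: fin => //; do ?apply: measurableU;
    do ?apply: measurableD; do ?apply: measurableI; by []).
  apply: le_trans; first by apply: measureU2; exact: measurableD.
  apply: leeD.
    by rewrite measureD// -ge0_fin_numE// fin.
  rewrite measureD//; last by rewrite -ge0_fin_numE// fin.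
  have -> : T s @^-1` A `&` A = A `&` T s @^-1` A by rewrite setIC.
  apply: leeB => //; rewrite le_eqVlt; apply/orP; left; apply/eqP.
  exact: (flow_preserving flowT).
have lim0 : (fine (mu A) - fine (mu (A `&` T (t i) @` A))) *+ 2
    @[i --> \oo] --> 0.
  rewrite -[0](mul0rn _ 2) -[X in X *+ 2](subrr (fine (mu A))).
  apply: cvgMn; apply: cvgB; first exact: cvg_cst.
  by apply: fine_cvg; rewrite fineK// fin.
apply: (squeeze_cvgr (f := fun=> 0) _ _ lim0); last exact: cvg_cst.
by apply: nearW => i; rewrite bound andbT fine_ge0.
Qed.

End rigid_factor.

Theorem theorem4p1 (R : realType) (d : measure_display) (X : measurableType d)
    (mu : probability X R) (T : R -> X -> X) :
  standard_borel R X ->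
  measure_preserving_flow mu T ->
  has_rigid_factor mu T ->
  ~ almost_mixing mu T.
Proof.
move=> _ flowT [A [mA A_gt0 A_lt1 [t tp tA]]] mixT.
suff : mu A = 0%E \/ mu A = 1%E by case=> A01; rewrite A01 ?ltxx in A_gt0 A_lt1.
apply: (occupation_ae_const01 flowT mA) => h h0.
have mO := measurable_occupation flowT h mA.
have O_bnd x : 0 <= occupation T A h x <= h.
  by rewrite occupation_ge0 (occupation_le flowT)// ltW.
rewrite -(integral_occupation flowT mA (ltW h0)).
apply: (rigid_observable_ae_const flowT mO O_bnd ler01 _ _ tp mixT).
  by move=> s x s0; rewrite mul1r (occupation_lipschitz flowT)// ltW.
have lim0 : h * fine (mu ((A `\` T (t i) @^-1` A) `|` (T (t i) @^-1` A `\` A)))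
    @[i --> \oo] --> 0.
  rewrite -[0](mulr0 h); apply: cvgM; first exact: cvg_cst.
  exact: (rigid_symdiff_cvg flowT).
apply: (squeeze_cvgr (f := fun=> 0) _ _ lim0); last exact: cvg_cst.
apply: nearW => i; apply/andP; split.
  by apply: fine_ge0; apply: integral_ge0 => x _; rewrite lee_fin.
have mD : measurable ((A `\` T (t i) @^-1` A) `|` (T (t i) @^-1` A `\` A)).
  have mTA := measurable_flow_preimage flowT (t i) mA.
  by apply: measurableU; exact: measurableD.
rewrite -lee_fin (displacementE flowT mO O_bnd) EFinM fineK; last first.
  exact: fin_num_measure.
rewrite -(integral_occupation flowT mD (ltW h0)).
apply: ge0_le_integral => //.
- apply/measurable_EFinP/measurableT_comp => //; apply: measurable_funB => //.
  by apply: measurableT_comp => //; exact: (measurable_flow flowT).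
- by apply/measurable_EFinP; exact: (measurable_occupation flowT).
- by move=> x _; rewrite lee_fin (occupation_symdiff flowT)// ltW.
Qed.
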